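(* Let $(\lambda_k)_{k\ge 1}$ be a nondecreasing sequence of positive real numbers tending to infinity with $\lambda_1=1$ and $\lambda_{k+1}\le\lambda_k+1$ for all $k$, and let $1<p<\infty$. Then the space $V_p(\lambda)$, equipped with the norm $\|\cdot\|_{V_p(\lambda)}$, has the Banach-Saks property of type $p$.
   Context: $\ell^0$ denotes the space of all real sequences $x=(x_j)_{j\ge1}$, with coordinatewise operations. For each $k\ge1$, $I_k=[k-\lambda_k+1,k]$, and $j\in I_k$ means that $j$ is a positive integer with $k-\lambda_k+1\le j\le k$. The space $V_p(\lambda)$ is $$V_p(\lambda)=\left\{x=(x_j)\in\ell^0:\ \sum_{k=1}^{\infty}\left(\frac{1}{\lambda_k}\sum_{j\in I_k}|x_j|\right)^{p}<\infty\right\}$$ with norm $$\|x\|_{V_p(\lambda)}=\left(\sum_{k=1}^{\infty}\left(\frac{1}{\lambda_k}\sum_{j\in I_k}|x_j|\right)^{p}\right)^{1/p},$$ under which it is a Banach space. For $1<p<\infty$, a Banach space $X$ has the Banach-Saks property of type $p$ if every weakly null sequence $(x_k)$ in $X$ has a subsequence $(x_{k_l})_{l\ge0}$ such that, for some $C>0$, $$\left\|\sum_{l=0}^{n}x_{k_l}\right\|<C(n+1)^{1/p}\quad\text{for all } n\in\mathbb{N}.$$ *)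

(* Defs.v *)
From HB Require Import structures.
From mathcomp Require Import all_boot all_order all_algebra.
From mathcomp Require Import all_classical all_reals all_analysis.
Import Order.TTheory GRing.Theory Num.Theory.
Import numFieldNormedType.Exports.

Set Implicit Arguments.
Unset Strict Implicit.
Unset Printing Implicit Defensive.

Local Open Scope classical_set_scope.
Local Open Scope ring_scope.

Definition weakly_null (R : realType) (X : normedModType R) (x : X^nat) : Prop :=
  forall f : {linear X -> R^o}, continuous f -> f \o x @ \oo --> (0 : R^o).

Definition Banach_Saks_type (R : realType) (p : R)
    (X : completeNormedModType R) : Prop :=
  forall x : X^nat, weakly_null x ->
  exists s : nat -> nat, increasing_seq s /\
  exists C : R, 0 < C /\
    forall n : nat, `| \sum_(0 <= l < n.+1) x (s l) | < C * n.+1%:R `^ p^-1.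

(* All sequences are shifted to start at 0: for x, lam : nat -> R, [x j] stands
   for x_{j+1} and [lam k] for lambda_{k+1}. *)

Record Vweight (R : realType) (lam : nat -> R) : Prop := MkVweight {
  Vweight_gt0 : forall k, 0 < lam k ;
  Vweight_homo : nondecreasing_seq lam ;
  Vweight_cvg : lam @ \oo --> +oo ;
  Vweight_first : lam 0%N = 1 ;
  Vweight_step : forall k, lam k.+1 <= lam k + 1
}.

(* The sum ranges over the j with j+1 in I_{k+1} = [(k+1)-lambda_{k+1}+1, k+1]. *)
Definition Vmean (R : realType) (lam : nat -> R) (x : nat -> R) (k : nat) : R :=
  (lam k)^-1 * \sum_(j < k.+1 | k.+1%:R - lam k + 1 <= j.+1%:R) `|x j|.

Definition Vsum (R : realType) (lam : nat -> R) (p : R) (x : nat -> R) : \bar R :=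
  (\sum_(0 <= k <oo) (Vmean lam x k `^ p)%:E)%E.

Definition Vnorm (R : realType) (lam : nat -> R) (p : R) (x : nat -> R) : R :=
  fine (Vsum lam p x) `^ p^-1.

Section Vspace.
Context (R : realType) (lam : nat -> R) (wlam : Vweight lam).
Context (p : R) (p1 : 1 < p).

(* The two ignored proof arguments let the instances below, which need these
   hypotheses, be inferred from the type alone. *)
Definition Vpred of Vweight lam & 1 < p : {pred nat -> R} :=
  fun x => (Vsum lam p x < +oo)%E.
Local Notation inV := (Vpred wlam p1).

Record Vspace := MkVspace { Vseq :> nat -> R ; _ : Vseq \in inV }.

HB.instance Definition _ := [isSub for Vseq].
HB.instance Definition _ := [Choice of Vspace by <:].

Local Notation mean := (Vmean lam).
Local Notation sum := (Vsum lam p).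
Local Notation nrm := (Vnorm lam p).

Let p_gt0 : 0 < p. Proof. exact: lt_trans p1. Qed.
Let p_neq0 : p != 0. Proof. by rewrite gt_eqF. Qed.
Let lam_gt0 k : 0 < lam k. Proof. exact: Vweight_gt0. Qed.

Lemma Vweight_ge1 k : 1 <= lam k.
Proof. by rewrite -(Vweight_first wlam); exact: Vweight_homo. Qed.

Lemma Vmean_ge0 x k : 0 <= mean x k.
Proof. by rewrite mulr_ge0 ?invr_ge0 ?(ltW (lam_gt0 _))//; exact: sumr_ge0. Qed.

Lemma le_VmeanD x y k : mean (x + y) k <= mean x k + mean y k.
Proof.
rewrite -mulrDr ler_wpM2l ?invr_ge0 ?(ltW (lam_gt0 _))// -big_split/=.
by apply: ler_sum => j _; exact: ler_normD.
Qed.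

Lemma VmeanZ a (x : nat -> R^o) k : mean (a *: x) k = `|a| * mean x k.
Proof.
rewrite /Vmean mulrCA; congr (_ * _); rewrite mulr_sumr.
by apply: eq_bigr => j _; exact: normrM.
Qed.

Lemma Vmean_coord x j : `|x j| <= lam j * mean x j.
Proof.
rewrite /Vmean mulrA mulfV ?gt_eqF// mul1r.
rewrite (bigD1 ord_max)/= ?lerDl ?sumr_ge0//.
by rewrite -addrA gerDl addrC subr_le0 Vweight_ge1.
Qed.

Lemma Vsum_ge0 x : (0 <= sum x)%E.
Proof. by apply: nneseries_ge0 => k _ _; rewrite lee_fin powR_ge0. Qed.

Lemma Vsum_Lnorm x : (sum x `^ p^-1 = 'N[counting]_p%:E[EFin \o mean x])%E.
Proof.
rewrite Lnorm_counting//; congr (_ `^ _)%E; apply: eq_eseriesr => k _ /=.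
by rewrite ger0_norm ?Vmean_ge0// poweR_EFin.
Qed.

Lemma le_Vsum (x : nat -> R) (f : nat -> R) : (forall k, mean x k <= f k) ->
  (sum x <= \sum_(0 <= k <oo) (f k `^ p)%:E)%E.
Proof.
move=> xf; apply: lee_nneseries => k _; first by rewrite lee_fin powR_ge0.
rewrite lee_fin ge0_ler_powR ?nnegrE ?Vmean_ge0 ?(ltW p_gt0)//.
exact: le_trans (Vmean_ge0 _ _) (xf k).
Qed.

Lemma Vsum_minkowski (x y : nat -> R) :
  (sum (x + y)%R `^ p^-1 <= sum x `^ p^-1 + sum y `^ p^-1)%E.
Proof.
rewrite !Vsum_Lnorm; set N := Lnorm _ _.
have h : (sum (x + y)%R `^ p^-1 <= N (EFin \o (mean x \+ mean y)%R))%E.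
  rewrite /N Lnorm_counting//.
  apply: gt0_ler_poweR; first by rewrite invr_ge0 ltW.
  - by rewrite in_itv/= Vsum_ge0 leey.
  - rewrite in_itv/= leey andbT.
    by apply: nneseries_ge0 => k _ _; rewrite lee_fin powR_ge0.
  - apply: le_trans (le_Vsum (le_VmeanD x y)) _.
    rewrite le_eqVlt; apply/orP; left; apply/eqP/eq_eseriesr => k _ /=.
    by rewrite ger0_norm ?addr_ge0 ?Vmean_ge0// poweR_EFin.
rewrite {1}/N -Vsum_Lnorm; apply: le_trans h _.
by apply: minkowski_EFin => //; exact: ltW.
Qed.

Lemma VsumZ a (x : nat -> R^o) : (sum (a *: x)%R = (`|a| `^ p)%:E * sum x)%E.
Proof.
rewrite /Vsum -nneseriesZl => [|k _]; last by rewrite lee_fin powR_ge0.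
by apply: eq_eseriesr => k _; rewrite VmeanZ powRM ?Vmean_ge0// EFinM.
Qed.

Lemma Vsum0 : sum 0 = 0%E.
Proof.
apply: eseries0 => k _ _; rewrite /Vmean big1 ?mulr0 ?powR0// => j _.
exact: normr0.
Qed.

Lemma Vpred_submod_closed : submod_closed (inV : {pred nat -> R^o}).
Proof.
split; first by rewrite unfold_in Vsum0 ltey.
move=> a x y; rewrite !unfold_in => hx hy.
apply: (@lty_poweRy _ _ p^-1); first by rewrite invr_eq0.
apply: le_lt_trans (Vsum_minkowski _ _) _.
apply: lte_add_pinfty; apply: poweR_lty => //.
by rewrite VsumZ lte_mul_pinfty// lee_fin powR_ge0.
Qed.

HB.instance Definition _ := GRing.isSubmodClosed.Build R (nat -> R^o) inV
  Vpred_submod_closed.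
HB.instance Definition _ := [SubChoice_isSubLmodule of Vspace by <:].

Lemma Vsum_fin_num (x : Vspace) : sum x \is a fin_num.
Proof. by rewrite ge0_fin_numE ?Vsum_ge0//; exact: valP x. Qed.

Lemma EFin_Vnorm (x : Vspace) : (nrm x)%:E = (sum x `^ p^-1)%E.
Proof. by rewrite /Vnorm -fine_poweR fineK// fin_num_poweR// Vsum_fin_num. Qed.

Lemma Vmean_le_Vnorm (x : Vspace) k : mean x k <= nrm x.
Proof.
have -> : mean x k = (mean x k `^ p) `^ p^-1.
  by rewrite -powRrM mulfV// powRr1 ?Vmean_ge0.
rewrite ge0_ler_powR ?invr_ge0 ?nnegrE ?powR_ge0 ?fine_ge0 ?Vsum_ge0 ?(ltW p_gt0)//.
rewrite -lee_fin fineK ?Vsum_fin_num//.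
have := @nneseries_lim_ge R (fun k => (mean x k `^ p)%:E) xpredT 0 k.+1.
move=> /(_ (fun _ _ _ => powR_ge0 _ _)); apply: le_trans.
rewrite big_nat_recr//= leeDr// sume_ge0// => i _.
by rewrite lee_fin powR_ge0.
Qed.

Lemma Vcoord_le (x : Vspace) j : `|x j| <= lam j * nrm x.
Proof.
by rewrite (le_trans (Vmean_coord x j))// ler_wpM2l ?Vmean_le_Vnorm// ltW.
Qed.

Lemma Vnorm_triangle (x y : Vspace) : nrm (x + y : Vspace) <= nrm x + nrm y.
Proof.
have le_fine (a b c : R) (A B C : \bar R) : a%:E = A -> b%:E = B -> c%:E = C ->
  (A <= B + C)%E -> a <= b + c by move=> <- <- <-.
exact: (le_fine _ _ _ _ _ _ (EFin_Vnorm (x + y)) (EFin_Vnorm x) (EFin_Vnorm y)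
  (Vsum_minkowski x y)).
Qed.

Lemma VnormZ a (x : Vspace) : nrm (a *: x : Vspace) = `|a| * nrm x.
Proof.
have -> : nrm (a *: x : Vspace) = fine ((`|a| `^ p)%:E * sum x)%E `^ p^-1.
  by rewrite -(VsumZ a x).
rewrite -(@fineK _ (sum x)) ?Vsum_fin_num// -EFinM/= powRM ?powR_ge0//.
  by rewrite -powRrM mulfV// powRr1.
by rewrite fine_ge0// Vsum_ge0.
Qed.

Lemma Vnorm_eq0 (x : Vspace) : nrm x = 0 -> x = 0.
Proof.
move=> x0; apply/val_inj/funext => j /=; apply/eqP; rewrite -normr_le0.
by rewrite (le_trans (Vcoord_le x j))// x0 mulr0.
Qed.

HB.instance Definition _ := Lmodule_isNormed.Build R Vspace
  Vnorm_triangle VnormZ Vnorm_eq0.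

Lemma Vspace_normE (x : Vspace) : `|x| = Vnorm lam p x.
Proof. by []. Qed.

Lemma norm_powR_continuous : continuous (fun a : R => `|a| `^ p).
Proof.
move=> a; have [->|a0] := eqVneq a 0.
  rewrite /continuous_at normr0 powR0//; apply/cvgrPdist_lt => e e0.
  near=> x; rewrite sub0r normrN ger0_norm ?powR_ge0//.
  have -> : e = (e `^ p^-1) `^ p by rewrite -powRrM mulVf// powRr1// ltW.
  apply: gt0_ltr_powR => //; rewrite ?nnegrE ?powR_ge0//.
  by near: x; apply: cvgr0_norm_lt => //; exact: powR_gt0.
apply: (@continuous_comp _ _ _ (fun a : R => `|a|) (fun b : R => b `^ p)).
  exact: norm_continuous.
apply: differentiable_continuous; apply/derivable1_diffP.
by apply: derivable_powR; rewrite in_itv/= andbT normr_gt0.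
Unshelve. all: by end_near. Qed.

Lemma Vspace_complete (F : set_system Vspace) :
  ProperFilter F -> cauchy F -> cvg F.
Proof.
move=> FF /cauchy_ballP Fc.
have Fdist e : 0 < e -> \forall x & x' \near F, `|x - x'| < e.
  by move=> /Fc; rewrite -ball_normE.
have cvc j : cvg ((fun x : Vspace => x j : R^o) @ F).
  apply: cauchy_cvg; apply/cauchy_ballP => e e0; rewrite !near_map2.
  have := Fdist (e / lam j) (divr_gt0 e0 (lam_gt0 j)).
  apply: filterS => -[x x'] /= xx'; rewrite -ball_normE/=.
  apply: le_lt_trans (Vcoord_le (x - x') j) _.
  by rewrite mulrC -ltr_pdivlMr.
pose y j : R := lim ((fun x : Vspace => x j : R^o) @ F).
have yc j : (fun x : Vspace => x j : R^o) @ F --> (y j : R^o) by exact: cvc.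
have key e : 0 < e ->
    \forall x \near F, (sum (Vseq x - y)%R `^ p^-1 <= e%:E)%E.
  move=> e0; near=> x.
  have xF : \forall x' \near F, `|x - x'| < e.
    by near: x; apply: nearP_dep; exact: Fdist.
  have -> : e%:E = ((e `^ p)%:E `^ p^-1)%E.
    by rewrite poweR_EFin -powRrM mulfV// powRr1// ltW.
  apply: gt0_ler_poweR; first by rewrite invr_ge0 ltW.
  - by rewrite in_itv/= Vsum_ge0 leey.
  - by rewrite in_itv/= leey lee_fin powR_ge0.
  apply: lime_le.
    by apply: is_cvg_nneseries => k _ _; rewrite lee_fin powR_ge0.
  apply: nearW => n; rewrite sumEFin lee_fin.
  pose S (z : nat -> R) : R := \sum_(0 <= k < n) `|mean (Vseq x - z) k| `^ p.
  have -> : \sum_(0 <= k < n) mean (Vseq x - y) k `^ p = S y.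
    by apply: eq_bigr => k _; rewrite ger0_norm ?Vmean_ge0.
  have Sc : (fun z : Vspace => S z) @ F --> S y.
    apply: (cvg_big (@add_continuous _)) => k _.
    have mc : mean (Vseq x - Vseq z) k @[z --> F] --> mean (Vseq x - y) k.
      apply: cvgM; first exact: cvg_cst.
      apply: (cvg_big (@add_continuous _)) => j _; apply: cvg_norm.
      by apply: cvgB; [exact: cvg_cst|exact: yc].
    exact: (continuous_cvg _ (@norm_powR_continuous _) mc).
  rewrite -(cvg_lim _ Sc)//; apply: limr_le; first by apply/cvg_ex; exists (S y).
  near=> z; have xz : `|x - z| < e by near: z; exact: xF.
  pose w : Vspace := x - z; have we : nrm w < e by exact: xz.
  have : (sum w <= (e `^ p)%:E)%E.
    rewrite -(fineK (Vsum_fin_num w)) lee_fin.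
    have <- : nrm w `^ p = fine (sum w).
      by rewrite -powRrM mulVf// powRr1// fine_ge0// Vsum_ge0.
    by rewrite ge0_ler_powR ?nnegrE ?powR_ge0 ?(ltW p_gt0) ?(ltW e0) ?(ltW we).
  rewrite -lee_fin; apply: le_trans.
  rewrite /S -sumEFin.
  under eq_bigr do rewrite ger0_norm ?Vmean_ge0//.
  apply: (@nneseries_lim_ge R (fun k => (mean w k `^ p)%:E) xpredT 0).
  by move=> k _ _; rewrite lee_fin powR_ge0.
have [x xy] := filter_ex (key 1 ltr01).
have yV : (y : nat -> R^o) \in inV.
  have -> : y = (x : nat -> R^o) - ((x : nat -> R^o) - (y : nat -> R^o)).
    by rewrite opprB addrC subrK.
  apply: rpredB; first exact: valP x.
  apply: (@lty_poweRy _ _ p^-1); first by rewrite invr_eq0.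
  exact: le_lt_trans xy (ltry _).
apply/cvg_ex; exists (MkVspace yV); apply/cvgrPdist_le => e e0.
apply: filterS (key e e0) => z hz.
by rewrite distrC -lee_fin [(_%:E)%E]EFin_Vnorm.
Unshelve. all: by end_near. Qed.

HB.instance Definition _ := Uniform_isComplete.Build Vspace Vspace_complete.

End Vspace.

(* Main.v *)
From HB Require Import structures.
Require Import Defs.
From mathcomp Require Import all_boot all_order all_algebra.
From mathcomp Require Import all_classical all_reals all_analysis.
From mathcomp Require Import lra ring.
Import Order.TTheory GRing.Theory Num.Theory.
Import numFieldNormedType.Exports.

Set Implicit Arguments.
Unset Strict Implicit.
Unset Printing Implicit Defensive.

Local Open Scope classical_set_scope.
Local Open Scope ring_scope.

(** Write m_k(x) for the k-th mean of |x|, so that the norm of x in V_p(lambda)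
is the l^p norm of (m_k(x))_k. Each m_k is a seminorm that depends on finitely
many coordinates.

The heart of the matter is a one-step estimate (Vnorm_add_eventually): if (x_n)
is weakly null and bounded by M, then for each fixed S, eventually in n,
|S + x_n|^p <= |S|^p + D with D = M^p + 1. Indeed cut the series of p-th powers
at an index N beyond which S has almost no mass. Before N there are finitely
many means, and since the coordinates of x_n tend to 0 they converge to those
of S; their contribution is at most |S|^p up to 1/2. After N, the triangle
inequality of l^p bounds the tail of S + x_n by the almost null tail of S plus
the norm of x_n, which contributes at most M^p up to 1/2.

Applying this repeatedly with S the sum of the terms already chosen gives a
subsequence whose partial sums satisfy |x_{s 0} + ... + x_{s n}|^p <= (n+1) D
(Banach_Saks_subsequence). This is a gliding hump in which the humps need not
be named: only the norms of the partial sums are followed.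

The bound M exists because a weakly null sequence is bounded
(weakly_null_bounded). The usual derivation, by the uniform boundedness
principle in the bidual, is replaced by a direct one: were the sequence
unbounded, a lacunary series of norming functionals, with suitable signs, would
be unbounded along it. In V_p(lambda) the norming functionals are explicit,
being those of l^p composed with signed means (Vspace_norming). *)

(** * Boundedness of weakly null sequences *)

Section WeaklyNullBounded.
Context (R : realType) (X : normedModType R).
Implicit Types (x y : X^nat) (f : X -> R).

Lemma weakly_null_cvg0 x f M : weakly_null x -> scalar f ->
  (forall z, `|f z| <= M * `|z|) -> f (x n) @[n --> \oo] --> 0.
Proof.
move=> x0 fl fM.
pose F : {linear X -> R^o} := HB.pack (f : X -> R^o)
  (GRing.isLinear.Build R X R^o *:%R f fl).
apply: (x0 F); apply/linear_bounded_continuous/linear_boundedP.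
near=> r => z; apply: le_trans (fM z) _; exact: ler_wpM2r.
Unshelve. all: by end_near. Qed.

(** Gliding hump without Baire categories: f is the sum of the 4^-m phi_m with
signs. The sign of the m-th term is that of the partial sum at y_m, so the m-th
term cannot be cancelled there by the earlier ones: the sum through m is at
least 4^-m |y_m| / 2 at y_m. The later terms weigh at most 4^-m / 3, which
leaves 4^-m |y_m| / 6. *)
Lemma exists_resonant_functional y (phi : nat -> X -> R) :
  (forall m, scalar (phi m)) ->
  (forall m z, `|phi m z| <= `|z|) ->
  (forall m, `|y m| <= 2 * phi m (y m)) ->
  exists f (M : R), [/\ scalar f, forall z, `|f z| <= M * `|z| &
    forall m, `|y m| <= 6 * 4 ^+ m * `|f (y m)|].
Proof.
move=> phil phi1 phiy.
(* Unlike Num.sg, this sign is nonzero at 0. *)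
pose sgn (a : R) : R := if 0 <= a then 1 else -1.
have sgn1 a : `|sgn a| = 1 by rewrite /sgn; case: ifP; rewrite ?normrN normr1.
pose g := fix g n z : R :=
  if n is m.+1 then g m z + sgn (g m (y m)) * (4^-1 ^+ m * phi m z) else 0.
have gl n : scalar (g n).
  elim: n => [|n ih] a u v /=; first by rewrite mulr0 addr0.
  by rewrite ih phil; ring.
have gstep n z : `|g n.+1 z - g n z| <= 4^-1 ^+ n * `|z|.
  rewrite /= [_ + _ * _]addrC addrK normrM sgn1 mul1r normrM.
  by rewrite ger0_norm ?exprn_ge0// ler_wpM2l ?exprn_ge0.
have gtail n k z : `|g (n + k)%N z - g n z| <=
    4 / 3 * (4^-1 ^+ n - 4^-1 ^+ (n + k)) * `|z|.
  elim: k => [|k ih]; first by rewrite addn0 !subrr mulr0 mul0r normr0.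
  rewrite addnS.
  have -> : g (n + k).+1 z - g n z =
    (g (n + k).+1 z - g (n + k)%N z) + (g (n + k)%N z - g n z) by ring.
  apply: le_trans (ler_normD _ _) _.
  apply: le_trans (lerD (gstep _ _) ih) _.
  rewrite -mulrDl ler_wpM2r//.
  by rewrite exprS; set a := _ ^+ n; set b := _ ^+ (_ + _); lra.
have gc z : cvgn (g ^~ z).
  have -> : g ^~ z = series (fun n => g n.+1 z - g n z).
    by apply/funext => n; rewrite /series/= telescope_sumr// subr0.
  apply: normed_cvg.
  apply: (@series_le_cvg _ _ (fun n => `|z| * 4^-1 ^+ n)) => //.
  - by move=> n /=; exact: normr_ge0.
  - by move=> n; rewrite [leRHS]mulrC; exact: gstep.
  - by apply: is_cvg_geometric_series; rewrite ger0_norm; lra.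
pose f z : R := limn (g ^~ z).
have gf z : g n z @[n --> \oo] --> f z by exact: gc.
have ftail n z : `|f z - g n z| <= 4 / 3 * 4^-1 ^+ n * `|z|.
  have h : `|g k z - g n z| @[k --> \oo] --> `|f z - g n z|.
    by apply: cvg_norm; apply: cvgB; [exact: gf | exact: cvg_cst].
  rewrite -(cvg_lim _ h)//; apply: limr_le; first exact: cvgP h.
  near=> k; have nk : (n <= k)%N by near: k; exact: nbhs_infty_ge.
  rewrite -(subnKC nk); apply: le_trans (gtail _ _ _) _.
  rewrite ler_wpM2r// ler_wpM2l ?divr_ge0// lerBlDr lerDl exprn_ge0//.
exists f, (4 / 3); split.
- move=> a u v; apply/cvg_lim => //; under eq_fun do rewrite gl.
  by apply: cvgD; [apply: cvgM; [exact: cvg_cst|exact: gf]|exact: gf].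
- by move=> z; have := ftail 0%N z; rewrite /= subr0 expr0 mulr1.
move=> m; have := ftail m.+1 (y m) => /=.
set G := g m (y m); set P := phi m (y m); set a : R := _ ^+ m.
have a0 : 0 < a by rewrite exprn_gt0.
have P0 : 0 <= P by have := phiy m; have := normr_ge0 (y m); rewrite -/P; lra.
(* The choice of the sign: G and the new term add up in absolute value. *)
have -> : `|f (y m) - (G + sgn G * (a * P))| =
          `|f (y m) - sgn G * (`|G| + a * P)|.
  rewrite /sgn; case: ifPn => [/ger0_norm ->|]; first by congr (`|_ - _|); ring.
  by rewrite -ltNge => /ltr0_norm ->; congr (`|_ - _|); ring.
move=> h.
have := ler_distD (f (y m)) (sgn G * (`|G| + a * P)) 0.
rewrite !subr0 [X in _ <= X + _]distrC.
rewrite normrM sgn1 mul1r ger0_norm; last by rewrite addr_ge0 ?mulr_ge0 ?(ltW a0).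
move=> h2.
have : a * `|y m| <= 6 * `|f (y m)|.
  have : a * `|y m| <= a * (2 * P) by rewrite ler_wpM2l ?(ltW a0) ?phiy.
  move: h; rewrite exprS -/a; have := normr_ge0 G.
  set F := `|f (y m)|; set Y := `|y m|.
  rewrite -!mulrA; set aY := a * Y; move: h2.
  rewrite (mulrCA a 2); set aP := a * P.
  rewrite -/F; lra.
move=> h3; rewrite -mulrA mulrCA -ler_pdivrMl ?exprn_gt0//.
by rewrite -exprVn.
Unshelve. all: by end_near. Qed.

(** The functionals phi stand for the consequence of the Hahn-Banach theorem
that the argument needs, with a factor 2 to spare, so that in a concrete space
they may be built from a truncation of z. *)
Lemma weakly_null_bounded x :
  (forall z : X, exists phi : X -> R, [/\ scalar phi,
    forall w, `|phi w| <= `|w| & `|z| <= 2 * phi z]) ->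
  weakly_null x -> exists M, forall n, `|x n| <= M.
Proof.
move=> /choice[phi phiP] x0; apply: contrapT => unbdd.
have big (c : R) : exists n, c < `|x n|.
  apply: contrapT => hc; apply: unbdd; exists c => n.
  by rewrite leNgt; apply/negP => xc; apply: hc; exists n.
(* The factor m beats the constant 6 * 4 ^+ m lost by the resonant
   functional. *)
have [s sP] := choice (fun m => big (6 * 4 ^+ m * m%:R)).
pose y m := x (s m).
have [|||f [M [fl fM fy]]] :=
  @exists_resonant_functional y (fun m => phi (y m)).
- by move=> m; have [] := phiP (y m).
- by move=> m; have [] := phiP (y m).
- by move=> m; have [] := phiP (y m).
have /cvgP/cvg_seq_bounded/bounded_fun_has_ubound[B fB] :
  `|f (x n)| @[n --> \oo] --> `|0 : R|.
  by apply: cvg_norm; exact: (weakly_null_cvg0 x0 fl fM).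
have {}fB n : `|f (x n)| <= B by apply: fB; exists n.
pose m := (Num.truncn B).+1.
have Bm : B < m%:R by exact: truncnS_gt.
have := lt_le_trans (sP m) (fy m).
rewrite ltr_pM2l ?mulr_gt0 ?exprn_gt0// => mf.
by have := lt_le_trans (lt_trans Bm mf) (fB (s m)); rewrite ltxx.
Qed.

End WeaklyNullBounded.

(** * Adding a far term of a weakly null sequence *)

Section Vspace.
Context (R : realType) (lam : nat -> R) (wlam : Vweight lam).
Context (p : R) (p1 : 1 < p).
Local Notation V := (Vspace wlam p1).
Local Notation mean := (Vmean lam).
Implicit Types (x y z w S : V).

Let p_gt0 : 0 < p. Proof. exact: lt_trans p1. Qed.
Let p_neq0 : p != 0. Proof. by rewrite gt_eqF. Qed.

Lemma Vnorm_powR z : Vsum lam p z = (`|z| `^ p)%:E.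
Proof.
rewrite Vspace_normE /Vnorm -powRrM mulVf// powRr1 ?fine_ge0 ?Vsum_ge0//.
by rewrite fineK// Vsum_fin_num.
Qed.

Lemma Vpartial_le z n : \sum_(0 <= k < n) mean z k `^ p <= `|z| `^ p.
Proof.
rewrite -lee_fin -sumEFin -Vnorm_powR.
by apply: nneseries_lim_ge => k _ _; rewrite lee_fin powR_ge0.
Qed.

Lemma Vpartial_cvg z :
  \sum_(0 <= k < n) mean z k `^ p @[n --> \oo] --> `|z| `^ p.
Proof.
have /fine_cvgP[_] :
    (\sum_(0 <= k < n) (mean z k `^ p)%:E)%E @[n --> \oo] --> (`|z| `^ p)%:E.
  rewrite -Vnorm_powR.
  by apply: is_cvg_nneseries => k _ _; rewrite lee_fin powR_ge0.
by under [fine \o _]eq_fun do rewrite /= sumEFin.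
Qed.

Lemma Vcoord_cvg0 (u : V^nat) j : weakly_null u ->
  u n j @[n --> \oo] --> 0.
Proof.
move=> u0; apply: (weakly_null_cvg0 (f := fun z : V => z j) (M := lam j) u0) => //.
by move=> z; rewrite Vspace_normE; exact: Vcoord_le.
Qed.

Lemma Vmean_cvg (u : V^nat) S k : weakly_null u ->
  mean (S + u n : V) k @[n --> \oo] --> mean S k.
Proof.
move=> u0; apply: cvgM; first exact: cvg_cst.
apply: (cvg_big (@add_continuous _)) => j _; apply: cvg_norm.
rewrite -[X in _ --> X]addr0.
apply: cvgD; [exact: cvg_cst|exact: Vcoord_cvg0].
Qed.

(** Only finitely many coordinates enter a mean, and evaluation at a coordinate
is a continuous functional. *)
Lemma Vmean_powR_cvg (u : V^nat) S k : weakly_null u ->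
  mean (S + u n : V) k `^ p @[n --> \oo] --> mean S k `^ p.
Proof.
move=> u0.
have pc : {for mean S k, continuous (fun a : R => `|a| `^ p)} by
  exact: (@norm_powR_continuous R p p1).
have -> : (fun n => mean (S + u n : V) k `^ p) =
    (fun a : R => `|a| `^ p) \o (fun n => mean (S + u n : V) k).
  by apply/funext => n /=; rewrite ger0_norm ?(Vmean_ge0 wlam).
have := continuous_cvg _ pc (@Vmean_cvg u S k u0).
by rewrite ger0_norm ?(Vmean_ge0 wlam)//; apply.
Qed.

(** Shifting the index makes a tail the full l^p norm of a sequence, to which
the Minkowski inequality for the counting measure applies. *)
Lemma Vtail_Lnorm N (x : nat -> R) :
  ((\sum_(N <= k <oo) (mean x k `^ p)%:E) `^ p^-1 =
   'N[counting]_p%:E[EFin \o (fun k => mean x (k + N)%N)])%E.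
Proof.
rewrite (Lnorm_counting _ p_gt0); congr (_ `^ _)%E.
rewrite -nneseries_addn => [|k]; last by rewrite lee_fin powR_ge0.
apply: eq_eseriesr => k _ /=.
by rewrite ger0_norm ?(Vmean_ge0 wlam)// poweR_EFin.
Qed.

Lemma Vtail_minkowski N (x y : nat -> R) (a b : R) : 0 <= a -> 0 <= b ->
  (\sum_(N <= k <oo) (mean x k `^ p)%:E <= (a `^ p)%:E)%E ->
  (\sum_(N <= k <oo) (mean y k `^ p)%:E <= (b `^ p)%:E)%E ->
  (\sum_(N <= k <oo) (mean (x + y)%R k `^ p)%:E <= ((a + b) `^ p)%:E)%E.
Proof.
move=> a0 b0 xa yb.
have tail_ge0 (z : nat -> R) : (0 <= \sum_(N <= k <oo) (mean z k `^ p)%:E)%E.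
  by apply: nneseries_ge0 => k _ _; rewrite lee_fin powR_ge0.
have root (c : R) (z : nat -> R) : 0 <= c ->
    (\sum_(N <= k <oo) (mean z k `^ p)%:E <= (c `^ p)%:E)%E ->
    (((\sum_(N <= k <oo) (mean z k `^ p)%:E) `^ p^-1)%E <= c%:E)%E.
  move=> c0 zc.
  have -> : c%:E = ((c `^ p)%:E `^ p^-1)%E.
    by rewrite poweR_EFin -powRrM mulfV// powRr1.
  apply: gt0_ler_poweR zc; rewrite ?invr_ge0 ?(ltW p_gt0)// in_itv/= leey andbT//.
  by rewrite lee_fin powR_ge0.
have h : ('N[counting]_p%:E[EFin \o
    ((fun k => mean x (k + N)%N) \+ (fun k => mean y (k + N)%N))%R]
    <= (a + b)%:E)%E.
  apply: (le_trans (minkowski_EFin _ _ _ (ltW p1))) => //.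
  by rewrite EFinD; apply: leeD; rewrite -Vtail_Lnorm; exact: root.
have {h} : ((\sum_(N <= k <oo) (mean (x + y)%R k `^ p)%:E) `^ p^-1 <= (a + b)%:E)%E.
  apply: le_trans h; rewrite Vtail_Lnorm !(Lnorm_counting _ p_gt0).
  apply: gt0_ler_poweR; first by rewrite invr_ge0 ltW.
  - rewrite in_itv/= leey andbT.
    by apply: nneseries_ge0 => k _ _; rewrite lee_fin powR_ge0.
  - rewrite in_itv/= leey andbT.
    by apply: nneseries_ge0 => k _ _; rewrite lee_fin powR_ge0.
  apply: lee_nneseries => k _; first by rewrite lee_fin powR_ge0.
  rewrite lee_fin ge0_ler_powR ?nnegrE ?(ltW p_gt0)//.
  rewrite !ger0_norm ?addr_ge0 ?(Vmean_ge0 wlam)//.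
  exact: le_VmeanD.
move=> /(gt0_ler_poweR (ltW p_gt0)).
rewrite -poweRrM mulVf// poweRe1//.
rewrite !in_itv/= !leey !andbT poweR_ge0 lee_fin addr_ge0//.
by apply.
Qed.

(** Asymptotically S and u n have disjoint supports, so that the p-th powers of
their norms add up; the additive constant 1 absorbs one error 1/2 from the head
of the series and one from its tail. *)
Lemma Vnorm_add_eventually (u : V^nat) M S : weakly_null u ->
  (forall n, `|u n| <= M) ->
  \forall n \near \oo, `|S + u n| `^ p <= `|S| `^ p + (M `^ p + 1).
Proof.
move=> u0 uM; have M0 : 0 <= M by exact: le_trans (normr_ge0 _) (uM 0%N).
have [e e0 Me] : exists2 e, 0 < e & (e + M) `^ p <= M `^ p + 2^-1.
  have c : `|a| `^ p @[a --> M] --> `|M| `^ p := @norm_powR_continuous R p p1 M.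
  have : \forall a \near M, `|a| `^ p <= M `^ p + 2^-1.
    by apply: (cvgr_le _ c); rewrite ger0_norm// ltrDl invr_gt0 ltr0n.
  move=> /nbhs_ballP[d /= d0 dM]; exists (d / 2); first exact: divr_gt0.
  have := dM (d / 2 + M); rewrite /= ger0_norm ?addr_ge0 ?divr_ge0 ?(ltW d0)//.
  apply; rewrite /ball/= distrC addrK ger0_norm ?divr_ge0 ?(ltW d0)//.
  by rewrite ltr_pdivrMr// ltr_pMr// ltr1n.
have tail_ge0 z k : xpredT k -> (0 <= (mean z k `^ p)%:E)%E.
  by rewrite lee_fin powR_ge0.
have [N SN] : exists N, (\sum_(N <= k <oo) (mean S k `^ p)%:E <= (e `^ p)%:E)%E.
  have fin : (\sum_(0 <= k <oo) (mean S k `^ p)%:E < +oo)%E by exact: (valP S).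
  have ep0 : (0 < (e `^ p)%:E)%E by rewrite lte_fin powR_gt0.
  have /filter_ex[N /ltW NS] : \forall N \near \oo,
      (\sum_(N <= k <oo) (mean S k `^ p)%:E < (e `^ p)%:E)%E.
    exact: nneseries_tail_cvg fin (tail_ge0 S) _ (open_ereal_lt' ep0).
  by exists N.
have head : \forall n \near \oo,
    \sum_(0 <= k < N) mean (S + u n : V) k `^ p <= `|S| `^ p + 2^-1.
  apply: (@cvgr_le _ _ _ _ _ (\sum_(0 <= k < N) mean S k `^ p)).
    by apply: (cvg_big (@add_continuous _)) => k _; exact: Vmean_powR_cvg.
  by apply: (le_lt_trans (Vpartial_le S N)); rewrite ltrDl.
near=> n.
have tail : (\sum_(N <= k <oo) (mean (S + u n : V) k `^ p)%:E
    <= ((e + M) `^ p)%:E)%E.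
  apply: Vtail_minkowski => //; first exact: ltW.
  apply: (@le_trans _ _ (Vsum lam p (u n))).
    rewrite /Vsum (nneseries_split 0 N)//; last by move=> k _; exact: tail_ge0.
    by rewrite leeDr// sume_ge0// => k _; exact: tail_ge0.
  by rewrite Vnorm_powR lee_fin ge0_ler_powR ?nnegrE ?(ltW p_gt0).
rewrite -lee_fin -Vnorm_powR /Vsum (nneseries_split 0 N)//; last first.
  by move=> k _; exact: tail_ge0.
rewrite add0n sumEFin.
apply: le_trans (leeD (_ : _ <= (`|S| `^ p + 2^-1)%:E)%E tail) _.
  by rewrite lee_fin; near: n.
rewrite -EFinD lee_fin; apply: le_trans (lerD (lexx _) Me) _.
lra.
Unshelve. all: by end_near. Qed.

(** * Norming functionals on V_p(lambda) *)

(** Young's inequality with the conjugate exponent p / (p - 1) of p expressed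
through p; p - 1 is the exponent of the functional that norms a point of
l^p. *)
Lemma powR_young a b : 0 <= a -> 0 <= b ->
  a `^ (p - 1) * b <= (1 - p^-1) * a `^ p + p^-1 * b `^ p.
Proof.
move=> a0 b0; have q0 : 0 < p - 1 by rewrite subr_gt0.
have p1_neq0 : p - 1 != 0 by rewrite gt_eqF.
have := @conjugate_powR _ (a `^ (p - 1)) b (p / (p - 1)) p (powR_ge0 _ _) b0.
rewrite -powRrM mulrCA mulfV// mulr1 divr_gt0//.
have -> : (p / (p - 1))^-1 = 1 - p^-1 by field; apply/andP.
rewrite subrK => /(_ isT p_gt0 erefl).
by rewrite [_ / p]mulrC [_ * (1 - _)]mulrC.
Qed.

(** Hoelder's inequality on the unit balls. *)
Lemma sum_powR_young_le1 (a b : nat -> R) n :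
  (forall k, 0 <= a k) -> (forall k, 0 <= b k) ->
  \sum_(0 <= k < n) a k `^ p <= 1 -> \sum_(0 <= k < n) b k `^ p <= 1 ->
  \sum_(0 <= k < n) a k `^ (p - 1) * b k <= 1.
Proof.
move=> a0 b0 a1 b1.
apply: le_trans (ler_sum _ (fun k _ => powR_young (a0 k) (b0 k))) _.
rewrite big_split -!mulr_sumr -[leRHS](subrK p^-1).
by rewrite lerD// ler_piMr// ?subr_ge0 ?invr_ge0 ?invf_le1 ?(ltW p_gt0) ?(ltW p1).
Qed.

(** The functional that norms the sequence of means of z in l^p, truncated at
some K, composed with the signed means b_k, which satisfy b_k(z) = m_k(z) and
|b_k(w)| <= m_k(w). With N the l^p norm of the first K means of z, the
functional takes the value N at z, and K is such that |z| <= 2 N. Truncating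
keeps the functional a finite sum, at the price of the factor 2. *)
Lemma Vspace_norming z : exists phi : V -> R,
  [/\ scalar phi, forall w, `|phi w| <= `|w| & `|z| <= 2 * phi z].
Proof.
have [->|z0] := eqVneq z 0.
  exists (fun=> 0); split => [a u v|w|]; rewrite ?normr0 ?mulr0 ?addr0//.
have {z0} z0 : 0 < `|z| by rewrite normr_gt0.
have [K zK] : exists K, (`|z| / 2) `^ p <= \sum_(0 <= k < K) mean z k `^ p.
  have /filter_ex[K zK] : \forall n \near \oo,
      (`|z| / 2) `^ p <= \sum_(0 <= k < n) mean z k `^ p.
    apply: (cvgr_ge _ (@Vpartial_cvg z)).
    rewrite gt0_ltr_powR ?nnegrE ?divr_ge0 ?(ltW z0)//.
    by rewrite ltr_pdivrMr// ltr_pMr// ltr1n.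
  by exists K.
set A := \sum_(0 <= k < K) _ in zK; pose N := A `^ p^-1.
have A0 : 0 < A by apply: lt_le_trans zK; rewrite powR_gt0// divr_gt0.
have N0 : 0 < N by rewrite powR_gt0.
have NA : N `^ p = A by rewrite -powRrM mulVf// powRr1// ltW.
have zN : `|z| <= 2 * N.
  rewrite mulrC -ler_pdivrMr//.
  have -> : `|z| / 2 = ((`|z| / 2) `^ p) `^ p^-1.
    by rewrite -powRrM mulfV// powRr1// divr_ge0.
  by rewrite ge0_ler_powR ?invr_ge0 ?nnegrE ?powR_ge0 ?(ltW p_gt0) ?(ltW A0).
pose a k := mean z k / N.
have a0 k : 0 <= a k by rewrite divr_ge0 ?(Vmean_ge0 wlam)// ltW.
have aE : \sum_(0 <= k < K) a k `^ p = 1.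
  under eq_bigr do rewrite powRM ?(Vmean_ge0 wlam)// ?invr_ge0 ?(ltW N0)//.
  rewrite -mulr_suml -/A -NA.
  by rewrite -powRM ?invr_ge0 ?(ltW N0)// mulfV ?gt_eqF// powR1.
pose I k (j : 'I_k.+1) := k.+1%:R - lam k + 1 <= j.+1%:R.
pose b k w : R := (lam k)^-1 * \sum_(j < k.+1 | I k j) Num.sg (z j) * w j.
have bl k : scalar (b k).
  move=> c u v; rewrite [c * _]mulrCA -[RHS]mulrDr; congr (_ * _).
  rewrite mulr_sumr -big_split; apply: eq_bigr => j _ /=.
  by transitivity (Num.sg (z j) * (c * u j + v j)) => //; ring.
have bz k : b k z = mean z k.
  by congr (_ * _); apply: eq_bigr => j _; rewrite normrEsg.
have bw k w : `|b k w| <= mean w k.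
  have l0 : 0 <= (lam k)^-1 by rewrite invr_ge0 ltW ?(Vweight_gt0 wlam).
  rewrite normrM ger0_norm// ler_wpM2l//.
  apply: le_trans (ler_norm_sum _ _ _) _; apply: ler_sum => j _.
  by rewrite normrM normr_sg ler_piMl// lern1 leq_b1.
exists (fun w => \sum_(0 <= k < K) a k `^ (p - 1) * b k w); split.
- move=> c u v; rewrite mulr_sumr -big_split; apply: eq_bigr => k _.
  by rewrite bl mulrDr mulrCA.
- move=> w; have [->|w0] := eqVneq w 0.
    rewrite big1 ?normr0// => k _; rewrite /b big1 ?mulr0// => j _.
    by rewrite mulr0.
  have {w0} w0 : 0 < `|w| by rewrite normr_gt0.
  apply: le_trans (ler_norm_sum _ _ _) _.
  apply: (@le_trans _ _ (\sum_(0 <= k < K) a k `^ (p - 1) * mean w k)).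
    apply: ler_sum => k _.
    by rewrite normrM ger0_norm ?powR_ge0// ler_wpM2l ?powR_ge0.
  rewrite -[leRHS]mul1r -ler_pdivrMr// mulr_suml.
  under eq_bigr do rewrite -mulrA.
  apply: sum_powR_young_le1 => //; last 1 first.
  - rewrite -(ler_pM2l (powR_gt0 p w0)) mulr1 mulr_sumr.
    apply: le_trans (Vpartial_le w K); apply: ler_sum => k _.
    rewrite -powRM ?(ltW w0)//; last exact: divr_ge0 (Vmean_ge0 wlam _ _) (ltW w0).
    by rewrite mulrC divfK// gt_eqF.
  - by move=> k; exact: divr_ge0 (Vmean_ge0 wlam _ _) (ltW w0).
  - by rewrite aE.
- suff -> : \sum_(0 <= k < K) a k `^ (p - 1) * b k z = N by [].
  transitivity (\sum_(0 <= k < K) N * a k `^ p); last by rewrite -mulr_sumr aE mulr1.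
  apply: eq_bigr => k _; rewrite bz.
  have -> : mean z k = N * a k by rewrite /a mulrC divfK ?gt_eqF.
  rewrite mulrCA; congr (_ * _).
  rewrite -[X in _ * X = _](powRr1 (a0 k)) -powRD ?subrK//.
  by rewrite (negbTE p_neq0).
Qed.

End Vspace.

(** * Extraction of the subsequence *)

(** The bound for S + x n holds for all large n, so the next index may also be
taken beyond the last one. The recursion carries the partial sum together with
the last index. *)
Lemma Banach_Saks_subsequence (R : realType) (X : normedModType R) (p D : R)
    (x : X^nat) : 0 < p -> 0 <= D ->
  (forall S, \forall n \near \oo, `|S + x n| `^ p <= `|S| `^ p + D) ->
  exists s : nat -> nat, increasing_seq s /\
  exists C : R, 0 < C /\
    forall n : nat, `| \sum_(0 <= l < n.+1) x (s l) | < C * n.+1%:R `^ p^-1.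
Proof.
move=> p0 D0 xD.
have /choice[h hP] : forall Si : X * nat, exists j,
    (Si.2 < j)%N /\ `|Si.1 + x j| `^ p <= `|Si.1| `^ p + D.
  move=> [S i] /=; near \oo => j; exists j; split; near: j; last exact: xD.
  exact: nbhs_infty_gt.
pose st := fix st n : X * nat :=
  if n is m.+1 then let j := h (st m) in ((st m).1 + x j, j) else (0, 0%N).
(* The seed index 0 of st is no term of the subsequence: the l-th term is
   chosen in passing from st l to st l.+1. *)
exists (fun l => (st l.+1).2); split.
  by apply/increasing_seqP => n; have [] := hP (st n.+1).
have sumE n : \sum_(0 <= l < n) x (st l.+1).2 = (st n).1.
  elim: n => [|n ih]; first by rewrite big_geq.
  by rewrite big_nat_recr//= ih.
have bd n : `|(st n).1| `^ p <= n%:R * D.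
  elim: n => [|n ih] /=; first by rewrite normr0 powR0 ?mul0r// gt_eqF.
  have [_ /le_trans] := hP (st n); apply.
  by rewrite -natr1 mulrDl mul1r lerD2r.
(* The summand 1 makes the inequality strict. *)
exists (D `^ p^-1 + 1); split; first by rewrite ltr_wpDl ?powR_ge0.
move=> n; rewrite sumE; set S := (st _).1.
have -> : `|S| = (`|S| `^ p) `^ p^-1.
  by rewrite -powRrM mulfV ?gt_eqF// powRr1.
apply: (@le_lt_trans _ _ ((n.+1%:R * D) `^ p^-1)).
  rewrite ge0_ler_powR ?invr_ge0 ?nnegrE ?powR_ge0 ?mulr_ge0 ?(ltW p0)//.
  exact: bd.
rewrite powRM// mulrC ltr_pM2r ?powR_gt0// ltrDl//.
Unshelve. all: by end_near. Qed.

Theorem theorem4p8 (R : realType) (lam : nat -> R) (wlam : Vweight lam)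
    (p : R) (p1 : 1 < p) :
  Banach_Saks_type p (Vspace wlam p1).
Proof.
move=> x x0.
have [M xM] := weakly_null_bounded (@Vspace_norming _ _ wlam _ p1) x0.
apply: (@Banach_Saks_subsequence _ _ p (M `^ p + 1)).
- exact: lt_trans ltr01 p1.
- by rewrite addr_ge0 ?powR_ge0.
- by move=> S; exact: Vnorm_add_eventually.
Qed.
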